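(* Let $p,q,c$ be integers with $q \geq p \geq 1$ and $c \geq p+q$. Define \[t_1 = 2p+q-1, \qquad t_2 = \begin{cases} \frac{(q-1)(p+q-1)}{q-p-1} & \text{if } q \geq p+2,\\ \infty & \text{if } q \leq p+1,\end{cases}\qquad t_3 = p+q-1+\sqrt{pq}, \qquad t_4 = q-1+\sqrt{(q-1)(q-p)}.\] Then $t_1 \leq t_2$, $t_1 \leq t_3$, and either $t_2 \leq t_3 \leq t_4$ or $t_4 \leq t_3 \leq t_2$. Moreover, there is a function $\varepsilon(n)=o(n^2)$ (depending on $p,q,c$) such that for every positive integer $n$, every collection of directed graphs $G_1, \ldots, G_c$ on a common set of $n$ vertices containing no rainbow $S_{p,q}$ satisfies the following. If $t_2 \leq t_3 \leq t_4$, then \[\min_{1 \leq i \leq c} e(G_i) \leq \begin{cases} \frac{(p+q-1)^2}{c^2}n^2 + \varepsilon(n) & \text{if } c \leq t_1,\\[3pt] \frac{(c-q+1)^2(p+q-1)^2}{4c^2p(c-p-q+1)}n^2+\varepsilon(n) &\text{if } t_1 \leq c \leq t_2,\\[3pt] \frac{q-1}{c}n^2 + \varepsilon(n) & \text{if } t_2 \leq c \leq t_4,\\[3pt] \frac{(c^2-(p-1)(q-1))^2}{4c^2(c-p+1)(c-q+1)}n^2 + \varepsilon(n) & \text{if } c \geq t_4. \end{cases}\] If $t_4 \leq t_3 \leq t_2$, then \[\min_{1 \leq i \leq c} e(G_i) \leq \begin{cases} \frac{(p+q-1)^2}{c^2}n^2 + \varepsilon(n) & \text{if } c \leq t_1,\\[3pt]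 \frac{(c-q+1)^2(p+q-1)^2}{4c^2p(c-p-q+1)}n^2+\varepsilon(n) &\text{if } t_1 \leq c \leq t_3,\\[3pt] \frac{(c^2-(p-1)(q-1))^2}{4c^2(c-p+1)(c-q+1)}n^2 + \varepsilon(n) & \text{if } c \geq t_3. \end{cases}\] Moreover, these bounds are tight up to a lower order error term: for every $n$ there is a collection on $n$ vertices with no rainbow $S_{p,q}$ whose minimum number of edges is at least the corresponding main term minus $o(n^2)$.
   Context: Each $G_i$ is a directed graph without loops or multiple edges on the common vertex set $V$ (for distinct $u,v$, the edges $uv$ and $vu$ may both be present); $e(G_i)$ denotes the number of directed edges of $G_i$. Think of $G_i$ as the edges of color $i$. For integers $p,q\ge 0$, $S_{p,q}$ denotes the orientation of a star on $p+q+1$ vertices whose center has indegree $p$ and outdegree $q$. The collection $(G_1,\ldots,G_c)$ contains a rainbow copy of a directed graph $F$ if there exist an injective map $f: V(F)\to V$ and an injective map $\varphi: E(F)\to\{1,\ldots,c\}$ such that for every edge $xy\in E(F)$, the edge $f(x)f(y)$ belongs to $G_{\varphi(xy)}$. *)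

(* Defs.v *)
From mathcomp Require Import all_boot all_order all_algebra.
From mathcomp Require Import all_classical all_reals all_analysis.
Set Implicit Arguments.
Unset Strict Implicit.
Unset Printing Implicit Defensive.
Import Order.TTheory GRing.Theory Num.Theory.
Import numFieldNormedType.Exports.
Local Open Scope ring_scope.

Record digraph (V : finType) := Digraph {
  arc :> rel V;
  arc_irr : irreflexive arc }.

Definition arcs (V : finType) (G : digraph V) : {set V * V} :=
  [set uv | G uv.1 uv.2].

Definition rainbow_copy (V W : finType) (c : nat) (G : 'I_c -> digraph V)
    (F : digraph W) : Prop :=
  exists (f : W -> V) (phi : {xy : W * W | xy \in arcs F} -> 'I_c),
    [/\ injective f, injective phi &
        forall e, G (phi e) (f (val e).1) (f (val e).2)].

(* The center is None, the in-neighbours are the Some (inl i), and the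
   out-neighbours are the Some (inr j). *)
Definition star_rel (p q : nat) : rel (option ('I_p + 'I_q)) :=
  fun x y => match x, y with
             | Some (inl _), None => true
             | None, Some (inr _) => true
             | _, _ => false
             end.

Fact star_irr p q : irreflexive (@star_rel p q).
Proof. by case=> [[]|]. Qed.

Definition star (p q : nat) : digraph (option ('I_p + 'I_q)%type) :=
  Digraph (@star_irr p q).

(* A digraph on V has at most #|V| ^ 2 arcs, so the default value does not
   affect the minimum as soon as 0 < c. *)
Definition min_arcs (V : finType) (c : nat) (G : 'I_c -> digraph V) : nat :=
  \big[minn/(#|V| ^ 2)%N]_(i < c) #|arcs (G i)|.

Section Thresholds.
Variables (R : realType) (p q : nat).
Let P : R := p%:R.
Let Q : R := q%:R.

Definition t1 : R := 2 * P + Q - 1.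

Definition t2 : \bar R :=
  if (p + 2 <= q)%N then ((Q - 1) * (P + Q - 1) / (Q - P - 1))%:E else +oo%E.

Definition t3 : R := P + Q - 1 + Num.sqrt (P * Q).

Definition t4 : R := Q - 1 + Num.sqrt ((Q - 1) * (Q - P)).

Definition order_t234 : Prop := (t2 <= t3%:E <= t4%:E)%E.

Definition order_t432 : Prop := (t4%:E <= t3%:E <= t2)%E.

Variable c : nat.
Let C : R := c%:R.

Definition coef_low : R := (P + Q - 1) ^+ 2 / C ^+ 2.

Definition coef_mid : R :=
  (C - Q + 1) ^+ 2 * (P + Q - 1) ^+ 2 / (4 * C ^+ 2 * P * (C - P - Q + 1)).

Definition coef_out : R := (Q - 1) / C.

Definition coef_high : R :=
  (C ^+ 2 - (P - 1) * (Q - 1)) ^+ 2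
    / (4 * C ^+ 2 * (C - P + 1) * (C - Q + 1)).

(* B holds of the coefficient of n ^ 2 in every case that applies to c; at a
   common endpoint of two ranges both cases apply. *)
Definition in_each_case (B : R -> Prop) : Prop :=
  (order_t234 ->
     [/\ C <= t1 -> B coef_low,
         (t1%:E <= C%:E <= t2)%E -> B coef_mid,
         (t2 <= C%:E <= t4%:E)%E -> B coef_out
       & t4 <= C -> B coef_high]) /\
  (order_t432 ->
     [/\ C <= t1 -> B coef_low,
         t1 <= C <= t3 -> B coef_mid
       & t3 <= C -> B coef_high]).

End Thresholds.

(* Main.v *)
Require Import Defs.
From mathcomp Require Import all_boot all_order all_algebra.
From mathcomp Require Import all_classical all_reals all_analysis.
From mathcomp Require Import ring lra zify.
Set Implicit Arguments.
Unset Strict Implicit.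
Unset Printing Implicit Defensive.
Import Order.TTheory GRing.Theory Num.Theory.
Import numFieldNormedType.Exports.
Local Open Scope ring_scope.

(** At a vertex [v] let [A] (resp. [B]) be the set of colours in which [v] has
    out-degree (resp. in-degree) at least [p + q]. By Hall's condition and a
    greedy choice of the leaves, there is no rainbow star centred at [v] only if
    [#|A| < q], [#|B| < p] or [#|A :|: B| < p + q]; so [(#|A|, #|B|)] is
    dominated by one of the three points [(q - 1, c)], [(c, p - 1)] and
    [(m, m)], where [m = p + q - 1]. Up to O(n) arcs, colour [i] has at most
    [a_i * b_i] arcs, where [a_i] and [b_i] count the vertices with [i] in [A],
    resp. in [B]. Hence if [l s + u t <= g] at the three points, averaging
    [l a_i + u b_i] over [i] and AM-GM give a colour with at most
    [g ^ 2 / (4 l u c ^ 2) * n ^ 2 + O(n)] arcs. Conversely, colour sets that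
    are cyclic windows realise every point [(s, t)] of the triangle, with
    [s t / c ^ 2 * n ^ 2 - O(n)] arcs in each colour. The theorem thus amounts
    to maximising [s t] over the triangle, and each case of the statement says
    which vertex or side carries the maximum. *)

(** * Maximising the product over the triangle, and the order of the thresholds *)

Section Optimum.
Variables (R : realType) (p q c : nat).
Hypotheses (hp : (1 <= p)%N) (hpq : (p <= q)%N) (hc : (p + q <= c)%N).
Let P : R := p%:R.
Let Q : R := q%:R.
Let C : R := c%:R.

(* The dual certificate: [a] is the AM-GM bound [g ^ 2 / (4 l u c ^ 2)] given by
   the weights [l] and [u]. *)
Definition certified (a : R) : Prop :=
  exists l u g : R, [/\ 0 < l, 0 < u & 0 <= g] /\
   [/\ l * (Q - 1) + u * C <= g, l * C + u * (P - 1) <= g,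
       l * (P + Q - 1) + u * (P + Q - 1) <= g &
       a * (4 * l * u * C ^+ 2) = g ^+ 2].

(* [x], [y] and [z] are the proportions of vertices of the three types. *)
Definition attained (a : R) : Prop :=
  exists x y z : R, [/\ 0 <= x, 0 <= y, 0 <= z, x + y + z = 1 &
    ((Q - 1) * x + C * y + (P + Q - 1) * z) *
    (C * x + (P - 1) * y + (P + Q - 1) * z) = a * C ^+ 2].

Lemma natr_params : [/\ 1 <= P, P <= Q & P + Q <= C].
Proof. by rewrite /P /Q /C -natrD ler1n !ler_nat. Qed.

Lemma t2_fin : (p + 2 <= q)%N ->
  t2 R p q = ((Q - 1) * (P + Q - 1) / (Q - P - 1))%:E /\ P + 2 <= Q.
Proof.
by move=> h; rewrite /t2 h; split=> //; rewrite /P /Q -(natrD _ p 2) ler_nat.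
Qed.

Lemma t2_inf : ~~ (p + 2 <= q)%N -> t2 R p q = +oo%E /\ Q <= P + 1.
Proof.
move=> h; rewrite /t2 (negbTE h); split=> //.
rewrite /P /Q -(natrD _ p 1) ler_nat.
by move: h; rewrite -ltnNge addn2 addn1 ltnS.
Qed.

Lemma t1_le_t2 : ((t1 R p q)%:E <= t2 R p q)%E.
Proof.
have [P1 PQ PQC] := natr_params.
have [/t2_fin[-> h]|/t2_inf[-> _]] := boolP (p + 2 <= q)%N; last exact: leey.
rewrite lee_fin ler_pdivlMr /t1 -/P -/Q; last by lra.
(* The right side exceeds the left by [2 P ^ 2]. *)
nra.
Qed.

Lemma t1_le_t3 : t1 R p q <= t3 R p q.
Proof.
have [P1 PQ PQC] := natr_params.
rewrite /t1 /t3 -/P -/Q.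
suff : P <= Num.sqrt (P * Q) by lra.
rewrite -[leLHS]ger0_norm -?sqrtr_sqr ?ler_wsqrtr ?expr2 ?ler_wpM2l //.
Qed.

Lemma t234_or_t432 : order_t234 R p q \/ order_t432 R p q.
Proof.
have [P1 PQ PQC] := natr_params.
rewrite /order_t234 /order_t432.
have u0 : 0 < Num.sqrt P by rewrite sqrtr_gt0; lra.
have v0 : 0 < Num.sqrt Q by rewrite sqrtr_gt0; lra.
have uP : Num.sqrt P ^+ 2 = P by rewrite sqr_sqrtr //; lra.
have vQ : Num.sqrt Q ^+ 2 = Q by rewrite sqr_sqrtr //; lra.
have suv : Num.sqrt (P * Q) = Num.sqrt P * Num.sqrt Q by rewrite sqrtrM //; lra.
set u := Num.sqrt P in u0 uP suv; set v := Num.sqrt Q in v0 vQ suv.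
(* The signs of [t3 - t2] and of [t4 - t3] are both that of
   [D = v (Q - P - 1) - u (P + Q - 1)], because
   [(Q - 1) (Q - P) - (P + u v) ^ 2 = (u + v) D]. *)
have key : (Q - 1) * (Q - P) - (P + u * v) ^+ 2 =
    (u + v) * (v * (Q - P - 1) - u * (P + Q - 1)).
  by rewrite -uP -vQ; ring.
(* For finite [t2] this quantity is [(Q - P - 1) (t3 - t2)]. *)
have uD : u * (v * (Q - P - 1) - u * (P + Q - 1)) =
    u * v * (Q - P - 1) - P * (P + Q - 1).
  by rewrite -[X in _ = _ - X * _]uP; ring.
have w0 : 0 <= P + u * v by nra.
have t34 : (t3 R p q <= t4 R p q) = ((P + u * v) ^+ 2 <= (Q - 1) * (Q - P)).
  rewrite /t3 /t4 -/P -/Q suv -[X in _ = (_ <= X)]sqr_sqrtr; last by nra.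
  rewrite ler_sqr ?nnegrE ?sqrtr_ge0 //.
  by apply/idP/idP; lra.
have t43 : (t4 R p q <= t3 R p q) = ((Q - 1) * (Q - P) <= (P + u * v) ^+ 2).
  rewrite /t3 /t4 -/P -/Q suv -[X in _ = (X <= _)]sqr_sqrtr; last by nra.
  rewrite ler_sqr ?nnegrE ?sqrtr_ge0 //.
  by apply/idP/idP; lra.
rewrite !lee_fin t34 t43.
have [D0|D0] := lerP 0 (v * (Q - P - 1) - u * (P + Q - 1)).
- left; apply/andP; split; last by rewrite -subr_ge0 key; nra.
  have [/t2_fin[-> h]|/t2_inf[_ h]] := boolP (p + 2 <= q)%N; last first.
    (* An infinite [t2] means [Q - P - 1 <= 0], hence [D < 0], against [D0]. *)
    suff: False by [].
    have : 0 < u * (P + Q - 1) by rewrite mulr_gt0 //; lra.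
    have : v * (Q - P - 1) <= 0 by rewrite mulr_ge0_le0 //; lra.
    by lra.
  rewrite lee_fin ler_pdivrMr /t3 -/P -/Q ?suv; last by lra.
  have : 0 <= u * (v * (Q - P - 1) - u * (P + Q - 1)).
    by apply: mulr_ge0 => //; exact: ltW.
  by rewrite uD; lra.
- right; apply/andP; split; first by rewrite -subr_le0 key; nra.
  have [/t2_fin[-> h]|/t2_inf[-> h]] := boolP (p + 2 <= q)%N; last exact: leey.
  rewrite lee_fin ler_pdivlMr /t3 -/P -/Q ?suv; last by lra.
  have : u * (v * (Q - P - 1) - u * (P + Q - 1)) <= 0.
    by apply: mulr_ge0_le0; exact: ltW.
  by rewrite uD; lra.
Qed.

(** With [m = P + Q - 1], the maximum of [s t] sits at [(m, m)] for [low], on the side from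
    [(Q - 1, C)] to [(m, m)] for [mid], at [(Q - 1, C)] for [out], and on the side from [(Q - 1, C)]
    to [(C, P - 1)] for [high]. The weights [(l, u)] are proportional to the gradient [(t, s)] of
    the product there. *)
Lemma certified_and_attained_each :
  in_each_case p q c (fun a : R => certified a /\ attained a).
Proof.
have [P1 PQ PQC] := natr_params.
have s3 : Num.sqrt (P * Q) ^+ 2 = P * Q by rewrite sqr_sqrtr //; nra.
have s3_ge0 : 0 <= Num.sqrt (P * Q) by exact: sqrtr_ge0.
have s4 : Num.sqrt ((Q - 1) * (Q - P)) ^+ 2 = (Q - 1) * (Q - P).
  by rewrite sqr_sqrtr //; nra.
have s4_ge0 : 0 <= Num.sqrt ((Q - 1) * (Q - P)) by exact: sqrtr_ge0.
have le_t3 : C <= t3 R p q -> (C - (P + Q - 1)) ^+ 2 <= P * Q.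
  by rewrite /t3 -/P -/Q => h; rewrite -[leRHS]s3 ler_sqr ?nnegrE //; lra.
have ge_t3 : t3 R p q <= C -> P * Q <= (C - (P + Q - 1)) ^+ 2.
  by rewrite /t3 -/P -/Q => h; rewrite -[leLHS]s3 ler_sqr ?nnegrE //; lra.
have le_t4 : C <= t4 R p q -> (C - (Q - 1)) ^+ 2 <= (Q - 1) * (Q - P).
  by rewrite /t4 -/P -/Q => h; rewrite -[leRHS]s4 ler_sqr ?nnegrE //; lra.
have ge_t4 : t4 R p q <= C -> (Q - 1) * (Q - P) <= (C - (Q - 1)) ^+ 2.
  by rewrite /t4 -/P -/Q => h; rewrite -[leLHS]s4 ler_sqr ?nnegrE //; lra.
have low : C <= t1 R p q ->
    certified (coef_low R p q c) /\ attained (coef_low R p q c).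
  rewrite /t1 /coef_low -/P -/Q -/C => h; split.
    exists 1, 1, (2 * (P + Q - 1)); split; split; try lra.
    by field; lra.
  exists 0, 0, 1; split; try lra.
  by field; lra.
have mid : t1 R p q <= C -> C <= t3 R p q -> (C%:E <= t2 R p q)%E ->
    certified (coef_mid R p q c) /\ attained (coef_mid R p q c).
  rewrite /coef_mid -/P -/Q -/C => h1 /le_t3 h3 h2.
  have {}h2 : C * (Q - P - 1) <= (P + Q - 1) * (Q - 1).
    have [/t2_fin[e h]|/t2_inf[_ h]] := boolP (p + 2 <= q)%N; last by nra.
    by move: h2; rewrite e lee_fin ler_pdivlMr; lra.
  move: h1; rewrite /t1 -/P -/Q => h1.
  split.
    (* A normal of the side. The vertex [(C, P - 1)] satisfies the inequality iff
       [(C - m) ^ 2 <= P Q], which is [C <= t3]. *)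
    exists (C - P - Q + 1), P, ((P + Q - 1) * (C - Q + 1)).
    split; split; try nra.
    by field; apply/andP; split; lra.
  (* The second coordinate of the point of the side where [l s = u t = g / 2]; [t1 <= C] gives
     [m <= t], and [C <= t2] gives [t <= C]. *)
  pose t := (P + Q - 1) * (C - Q + 1) / (2 * P).
  exists ((t - (P + Q - 1)) / (C - P - Q + 1)), 0,
    (1 - (t - (P + Q - 1)) / (C - P - Q + 1)).
  split; try lra.
  - apply: divr_ge0; last by lra.
    by rewrite subr_ge0 ler_pdivlMr; nra.
  - rewrite subr_ge0 ler_pdivrMr; last by lra.
    suff : t <= C by lra.
    by rewrite ler_pdivrMr; nra.
  - by rewrite /t; field; apply/and3P; split; lra.
have out : (t2 R p q <= C%:E)%E -> C <= t4 R p q ->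
    certified (coef_out R q c) /\ attained (coef_out R q c).
  rewrite /coef_out -/P -/Q -/C => h2 /le_t4 h4.
  have [/t2_fin[e h]|/t2_inf[e _]] := boolP (p + 2 <= q)%N; last first.
    by move: h2; rewrite e leye_eq.
  move: h2; rewrite e lee_fin ler_pdivrMr => [h2|]; last by lra.
  split.
    (* The tangent of the hyperbola at [(Q - 1, C)]: [(m, m)] is below it by [t2 <= C], and
       [(C, P - 1)] by [C <= t4]. *)
    exists C, (Q - 1), (2 * C * (Q - 1)); split; split; try nra.
    by field; lra.
  exists 1, 0, 0; split; try lra.
  by field; lra.
have high : t4 R p q <= C -> t3 R p q <= C ->
    certified (coef_high R p q c) /\ attained (coef_high R p q c).
  rewrite /coef_high -/P -/Q -/C => /ge_t4 h4 /ge_t3 h3; split.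
    (* A normal of the side opposite [(m, m)], which satisfies the inequality by [t3 <= C]. *)
    exists (C - P + 1), (C - Q + 1), (C ^+ 2 - (P - 1) * (Q - 1)).
    split; split; try nra.
    by field; apply/and3P; split; lra.
  (* Again [u t = g / 2]; here [t <= C] comes from [t4 <= C]. *)
  pose t := (C ^+ 2 - (P - 1) * (Q - 1)) / (2 * (C - Q + 1)).
  exists ((t - (P - 1)) / (C - P + 1)), (1 - (t - (P - 1)) / (C - P + 1)), 0.
  split; try lra.
  - apply: divr_ge0; last by lra.
    by rewrite subr_ge0 ler_pdivlMr; nra.
  - rewrite subr_ge0 ler_pdivrMr; last by lra.
    suff : t <= C by lra.
    by rewrite ler_pdivrMr; nra.
  - by rewrite /t; field; apply/and3P; split; lra.
(* [mid] asks for [C] below both [t2] and [t3], [high] for [C] above both [t3] and [t4]; the order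
   of the thresholds supplies the bound that a case omits. *)
rewrite /in_each_case /order_t234 /order_t432 !lee_fin.
split=> /andP[].
- move=> t23 t34; split=> //.
  + move=> /andP[h1 h2]; apply: mid => //.
      by rewrite -lee_fin; apply: (le_trans h2).
  + by move=> /andP[]; exact: out.
  + by move=> h; apply: high => //; exact: le_trans h.
- move=> t43 t32; split=> //.
  + move=> /andP[h1 h2]; apply: mid => //.
    by apply: le_trans t32; rewrite lee_fin.
  + by move=> h; apply: high => //; exact: le_trans h.
Qed.

End Optimum.

(** * Systems of distinct representatives *)

Lemma card_set_pair (T U : finType) (P : pred (T * U)) :
  #|[set x | P x]| = (\sum_(t : T) #|[set u | P (t, u)]|)%N.
Proof.
rewrite -sum1dep_card; under [RHS]eq_bigr do rewrite -sum1dep_card.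
by rewrite pair_big_dep /=; apply: eq_bigl => -[].
Qed.

(** Every set is at least as large as the number of sets, so the values already chosen never exhaust
    the next one. *)
Lemma greedy_sdr (T : finType) (V : finType) (N : T -> {set V}) :
  (forall t, #|T| <= #|N t|)%N ->
  exists2 g : T -> V, injective g & forall t, g t \in N t.
Proof.
move=> hN.
have [g ginj gN] : exists2 g : T -> V, {in enum T &, injective g} &
    {in enum T, forall t, g t \in N t}.
  have : uniq (enum T) by exact: enum_uniq.
  elim: (enum T) => [_|t s IHs /= /andP[ts us]].
    (* The empty list imposes nothing, but a total map [T -> V] must exist even though [V] may be
       empty when [T] is. *)
    have N0 t : (0 < #|N t|)%N.
      by apply: leq_trans (hN t); apply/card_gt0P; exists t.
    by exists (fun t => xchoose (card_gt0P (N0 t))).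
  have [g ginj gN] := IHs us.
  have : (0 < #|N t :\: [set x in map g s]|)%N.
    rewrite cardsD subn_gt0; apply: leq_trans (hN t).
    have := subset_leq_card (finset.subsetIr (N t) [set x in map g s]).
    move/leq_ltn_trans; apply.
    rewrite cardsE (leq_ltn_trans (card_size _)) // size_map.
    have : uniq (t :: s) by rewrite /= ts.
    by move/card_uniqP => /= <-; exact: max_card.
  move=> /card_gt0P[v]; rewrite !inE => /andP[vs vN].
  exists (fun x => if x == t then v else g x).
    move=> x y; rewrite !inE.
    have gv z : z \in s -> g z <> v.
      by move=> zs gzv; move: vs; rewrite -gzv map_f.
    case: (x =P t) => [->|_] /=; case: (y =P t) => [->|_] //= xs ys.
    - by move=> /esym/gv; case.
    - by move=> /gv; case.
    - exact: ginj.
  move=> x; rewrite inE; case: (x =P t) => [->|_] //=; exact: gN.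
by exists g => [x y|x]; [apply: ginj|apply: gN]; rewrite mem_enum.
Qed.

(** The [q] elements of [A] are taken outside [B] as far as possible. Either [B] stays intact, or
    all of [A :\: B] is used and [#|A :|: B| - q] elements of [B] remain. *)
Lemma disjoint_sdr (T : finType) (A B : {set T}) (p q : nat) :
  (q <= #|A|)%N -> (p <= #|B|)%N -> (p + q <= #|A :|: B|)%N ->
  exists2 col : 'I_p + 'I_q -> T, injective col &
    (forall k, col (inl k) \in B) /\ (forall k, col (inr k) \in A).
Proof.
move=> hA hB hAB.
have [S [SA Sq Sp]] :
    exists S : {set T}, [/\ S \subset A, #|S| = q & (p <= #|B :\: S|)%N].
  have [h|h] := leqP q #|A :\: B|.
    have /card_geqP[s [us sz sub]] := h.
    exists [set x in s]; split.
    - apply/fintype.subsetP => x; rewrite inE => /sub.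
      by rewrite inE => /andP[].
    - by rewrite cardsE (card_uniqP us).
    - apply: leq_trans hB _; apply: subset_leq_card.
      apply/fintype.subsetP => x xB; rewrite !inE xB andbT.
      by apply/negP => /sub; rewrite inE xB.
  have h' : (q - #|A :\: B| <= #|A :&: B|)%N.
    by rewrite leq_subLR addnC cardsID.
  have /card_geqP[s [us sz sub]] := h'.
  have sAB : [set x in s] \subset A :&: B.
    by apply/fintype.subsetP => x; rewrite inE => /sub.
  have cs : #|[set x in s]| = (q - #|A :\: B|)%N.
    by rewrite cardsE (card_uniqP us).
  exists ((A :\: B) :|: [set x in s]); split.
  - rewrite finset.subUset finset.subsetDl /=.
    by apply: fintype.subset_trans sAB _; exact: finset.subsetIl.
  - rewrite cardsU (_ : _ :&: _ = finset.set0) ?cards0 ?subn0 ?cs.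
      by rewrite subnKC // ltnW.
    apply/finset.setP => x; rewrite !inE; apply/negP => /andP[/andP[xB _] /sub].
    by rewrite inE (negbTE xB) andbF.
  - have -> : B :\: (A :\: B :|: [set x in s]) = B :\: [set x in s].
      apply/finset.setP => x; rewrite !inE negb_or.
      by case: (x \in B); rewrite /= ?andbF.
    have sB : [set x in s] \subset B.
      by apply: fintype.subset_trans sAB _; exact: finset.subsetIr.
    rewrite cardsD (finset.setIidPr sB) cs.
    have e : (#|A :|: B| = #|A :\: B| + #|B|)%N.
      have := cardsUI A B; have := cardsID B A; lia.
    lia.
have cS : forall k : 'I_q, (k < #|S|)%N by move=> k; rewrite Sq.
have cB : forall k : 'I_p, (k < #|B :\: S|)%N.
  by move=> k; apply: leq_trans Sp.
pose col x := match x with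
  | inl k => enum_val (Ordinal (cB k))
  | inr k => enum_val (Ordinal (cS k)) end.
have colB k : col (inl k) \in B :\: S by exact: enum_valP.
have colS k : col (inr k) \in S by exact: enum_valP.
exists col.
  move=> [x|x] [y|y].
  - by move=> /enum_val_inj[/val_inj ->].
  - by move=> e; move: (colB x); rewrite e inE colS.
  - by move=> e; move: (colB y); rewrite -e inE colS.
  - by move=> /enum_val_inj[/val_inj ->].
split=> k; first by move: (colB k); rewrite inE => /andP[].
exact: (fintype.subsetP SA).
Qed.

(** * Colours of large degree at a vertex *)

Section Degrees.
Variables (V : finType) (p q c : nat) (G : 'I_c -> digraph V).

Definition rich_out (v : V) : {set 'I_c} :=
  [set i | p + q <= #|[set w | G i v w]|]%N.

Definition rich_in (v : V) : {set 'I_c} :=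
  [set i | p + q <= #|[set w | G i w v]|]%N.

(** Otherwise the leaves get distinct colours from the two sets, and each leaf then has at least
    [p + q] candidates, as many as there are leaves. Irreflexivity keeps the centre from being a
    leaf. *)
Lemma no_rainbow_star (v : V) : (0 < p)%N -> ~ rainbow_copy G (star p q) ->
  [\/ #|rich_out v| < q, #|rich_in v| < p |
      #|rich_out v :|: rich_in v| < p + q]%N.
Proof.
move=> p0 nocopy.
have [hA|hA] := ltnP #|rich_out v| q; first by constructor 1.
have [hB|hB] := ltnP #|rich_in v| p; first by constructor 2.
have [hU|hU] := ltnP #|rich_out v :|: rich_in v| (p + q)%N.
  by constructor 3.
case: nocopy.
have [col col_inj [colB colA]] := disjoint_sdr hA hB hU.
pose N (x : 'I_p + 'I_q) := match x with
  | inl _ => [set w | G (col x) w v] | inr _ => [set w | G (col x) v w] end.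
have [|g g_inj gN] := @greedy_sdr _ V N.
  move=> x; rewrite card_sum !card_ord.
  by case: x => k /=; [have := colB k|have := colA k]; rewrite inE.
have gv x : g x != v.
  apply/eqP => e; move: (gN x); rewrite /N.
  by case: x e => k e; rewrite inE e arc_irr.
(* The leaf end of an arc, which determines the arc; the default is reached only at [(None, None)],
   which is no arc. *)
pose leaf (e : option ('I_p + 'I_q) * option ('I_p + 'I_q)) :=
  if e.1 is Some x then x else odflt (inl (Ordinal p0)) e.2.
exists (fun x => if x is Some x' then g x' else v),
  (fun e => col (leaf (val e))).
split.
- move=> [x|] [y|] //.
  + by move=> /g_inj ->.
  + by move=> /eqP; rewrite (negbTE (gv x)).
  + by move=> /esym/eqP; rewrite (negbTE (gv y)).
- move=> [[x y] xy] [[x' y'] xy'] /col_inj /= e; apply: val_inj => /=.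
  move: xy xy' e; rewrite !inE /leaf /=.
  by case: x => [[k|k]|]; case: y => [[l|l]|]; case: x' => [[k'|k']|];
    case: y' => [[l'|l']|] //= _ _ [->].
- move=> [[x y] /= xy]; rewrite /leaf.
  move: (xy); rewrite inE.
  case: x {xy} => [[k|k]|]; case: y => [[l|l]|] //= _.
  + by have := gN (inl k); rewrite inE.
  + by have := gN (inr l); rewrite inE.
Qed.

Definition n_out (i : 'I_c) := #|[set v | i \in rich_out v]|.
Definition n_in (i : 'I_c) := #|[set v | i \in rich_in v]|.

(** An arc outside the product leaves a vertex of out-degree below [p + q] or enters one of
    in-degree below [p + q]. *)
Lemma card_arcs_le (i : 'I_c) :
  (#|arcs (G i)| <= n_out i * n_in i + 2 * ((p + q) * #|V|))%N.
Proof.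
pose D1 := [set uv | G i uv.1 uv.2 && (i \notin rich_out uv.1)].
pose D2 := [set uv | G i uv.1 uv.2 && (i \notin rich_in uv.2)].
have b1 : (#|D1| <= (p + q) * #|V|)%N.
  rewrite card_set_pair mulnC -sum_nat_const; apply: leq_sum => u _ /=.
  rewrite inE -ltnNge; case: ltnP => [/ltnW h|_].
    by under finset.eq_finset do rewrite andbT.
  by rewrite eq_card0 // => w; rewrite inE andbF.
have b2 : (#|D2| <= (p + q) * #|V|)%N.
  (* Swapping the ends lets the count run over the heads. *)
  have -> : #|D2| = #|[set wv | G i wv.2 wv.1 && (i \notin rich_in wv.1)]|.
    have sw_inj : injective (fun uv : V * V => (uv.2, uv.1)).
      by move=> [a b] [a' b'] [-> ->].
    rewrite -(card_imset _ sw_inj); apply: eq_card => -[a b]; rewrite !inE /=.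
    apply/imsetP/idP => [[[a' b']]|h].
      by rewrite !inE /= => h [-> ->].
    by exists (b, a); rewrite ?inE.
  rewrite card_set_pair mulnC -sum_nat_const; apply: leq_sum => u _ /=.
  rewrite inE -ltnNge; case: ltnP => [/ltnW h|_].
    by under finset.eq_finset do rewrite andbT.
  by rewrite eq_card0 // => w; rewrite inE andbF.
have sub : arcs (G i) \subset
    finset.setX [set v | i \in rich_out v] [set v | i \in rich_in v]
    :|: (D1 :|: D2).
  apply/fintype.subsetP => -[u w]; rewrite inE /= => uw; rewrite !inE /= uw /=.
  by do 2!case: (p + q <= _)%N.
apply: leq_trans (subset_leq_card sub) _.
apply: leq_trans (leq_card_setU _ _) _; rewrite cardsX leq_add2l.
apply: leq_trans (leq_card_setU _ _) _.
by rewrite mul2n -addnn leq_add.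
Qed.

End Degrees.

(** * Bounds on the minimum over the colours *)

Lemma min_arcs_le (V : finType) (c : nat) (G : 'I_c -> digraph V) i :
  (min_arcs G <= #|arcs (G i)|)%N.
Proof.
rewrite /min_arcs; elim: (index_enum _) (mem_index_enum i) => // j s IHs.
rewrite big_cons inE => /orP[/eqP <-|/IHs]; first exact: geq_minl.
exact: leq_trans (geq_minr _ _).
Qed.

(** The first hypothesis covers the default value of the big minimum. *)
Lemma le_min_arcs (R : realType) (V : finType) (c : nat)
    (G : 'I_c -> digraph V) (r : R) :
  r <= #|V|%:R ^+ 2 -> (forall i, r <= #|arcs (G i)|%:R) ->
  r <= (min_arcs G)%:R.
Proof.
move=> r0 rG; rewrite /min_arcs.
elim/big_ind: _ => [|a b ra rb|i _]; [by rewrite natrX| |exact: rG].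
by rewrite /minn; case: ifP.
Qed.

(** * Counting in cyclic windows *)

Lemma sum_window (F : nat -> nat) (c a : nat) :
  (\sum_(j < c) F ((a + j) %% c) = \sum_(j < c) F j)%N.
Proof.
case: c => [|c]; first by rewrite !big_ord0.
elim: a => [|a <-].
  by apply: eq_bigr => j _; rewrite add0n modn_small.
(* Shifting the start by one moves the first term to the end. *)
rewrite big_ord_recr [RHS]big_ord_recl /= addnC addSnnS modnDr addn0.
by congr (_ + _)%N; apply: eq_bigr => j _; rewrite /bump /= addSnnS.
Qed.

Lemma count_window (c k a : nat) : (k <= c)%N ->
  (\sum_(j < c) ((a + j) %% c < k) = k)%N.
Proof.
move=> kc; rewrite (sum_window (fun j => j < k : nat)).
transitivity (\sum_(j < c | (j < k)%N) 1)%N.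
  by rewrite [RHS]big_mkcond; apply: eq_bigr => j _; case: (j < k)%N.
by rewrite -(big_ord_widen c (fun=> 1%N) kc) sum1_card card_ord.
Qed.

(** Each of the [L %/ c] full periods contributes [k]; the incomplete one is dropped. *)
Lemma count_windows (c k a L : nat) : (k <= c)%N ->
  (k * (L %/ c) <= \sum_(j < L) ((a + j) %% c < k))%N.
Proof.
move=> kc; have := div.divn_eq L c; move: (L %/ c)%N (L %% c)%N => m r ->.
rewrite big_split_ord /=; apply: leq_trans (leq_addr _ _).
elim: m => [|m IHm]; first by rewrite muln0.
rewrite mulnSr mulSnr big_split_ord /= leq_add //.
under eq_bigr do rewrite addnA.
by rewrite count_window.
Qed.

Lemma count_three_windows (c i k1 k2 k3 n n1 n2 n3 : nat) :
  (k1 <= c)%N -> (k2 <= c)%N -> (k3 <= c)%N ->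
  n = (n1 + n2 + n3)%N ->
  (k1 * (n1 %/ c) + k2 * (n2 %/ c) + k3 * (n3 %/ c) <=
   \sum_(v < n) ((v + i) %% c <
     if (v < n1)%N then k1 else if (v < n1 + n2)%N then k2 else k3))%N.
Proof.
move=> h1 h2 h3 ->; rewrite !big_split_ord /= !leq_add //.
- apply: leq_trans (count_windows i n1 h1) _; apply: leq_sum => j _ /=.
  by rewrite ltn_ord addnC.
- apply: leq_trans (count_windows (n1 + i) n2 h2) _; apply: leq_sum => j _ /=.
  have -> : (n1 + j < n1)%N = false by lia.
  by rewrite ltn_add2l ltn_ord addnAC.
- apply: leq_trans (count_windows (n1 + n2 + i) n3 h3) _.
  apply: leq_sum => j _ /=.
  have -> : (n1 + n2 + j < n1)%N = false by lia.
  have -> : (n1 + n2 + j < n1 + n2)%N = false by lia.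
  by rewrite addnAC.
Qed.

(** * Handling the case distinction *)

Lemma in_each_case_impl (R : realType) (p q c : nat) (B B' : R -> Prop) :
  (forall a, B a -> B' a) -> in_each_case p q c B -> in_each_case p q c B'.
Proof.
move=> BB' [h1 h2]; split=> [/h1[l m o h]|/h2[l m h]].
  by split=> [/l|/m|/o|/h] /BB'.
by split=> [/l|/m|/h] /BB'.
Qed.

(** In either order of the thresholds the ranges cover every [c]. *)
Lemma some_case (R : realType) (p q c : nat) (B : R -> Prop) :
  order_t234 R p q \/ order_t432 R p q -> in_each_case p q c B ->
  exists a, B a.
Proof.
move=> ord [h1 h2]; case: ord => [/h1[l m o h]|/h2[l m h]].
  have [/l|/ltW c1] := leP c%:R (t1 R p q); first by exists (coef_low R p q c).
  have [c4|/ltW/h] := leP c%:R (t4 R p q); last by exists (coef_high R p q c).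
  have [c2|/ltW c2] := leP (c%:R)%:E (t2 R p q).
    by exists (coef_mid R p q c); apply: m; rewrite lee_fin c1.
  by exists (coef_out R q c); apply: o; rewrite c2 lee_fin.
have [/l|/ltW c1] := leP c%:R (t1 R p q); first by exists (coef_low R p q c).
have [c3|/ltW/h] := leP c%:R (t3 R p q); last by exists (coef_high R p q c).
by exists (coef_mid R p q c); apply: m; rewrite c1.
Qed.

(** * Weak duality and the upper bound *)

Section Bounds.
Variables (R : realType) (p q c : nat).
Hypotheses (hp : (1 <= p)%N) (hpq : (p <= q)%N) (hc : (p + q <= c)%N).

Let c_gt0 : (0 < c)%N. Proof. lia. Qed.

(** The point [(s, t)] is a convex combination of the three vertices, so [l s + u t <= g], and AM-GM
    bounds [s t]. *)
Lemma attained_le_certified (a b : R) :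
  attained p q c a -> certified p q c b -> a <= b.
Proof.
have C0 : 0 < c%:R :> R by rewrite ltr0n.
move=> [x [y [z [x0 y0 z0 xyz]]]].
set s := (X in X * _); set t := (X in _ * X) => st.
move=> [l [u [g [[l0 u0 g0] [h1 h2 h3 e]]]]].
have lust : l * s + u * t <= g.
  have -> : l * s + u * t = x * (l * (q%:R - 1) + u * c%:R) +
     y * (l * c%:R + u * (p%:R - 1)) +
     z * (l * (p%:R + q%:R - 1) + u * (p%:R + q%:R - 1)) by rewrite /s /t; ring.
  have <- : x * g + y * g + z * g = g by rewrite -!mulrDl xyz mul1r.
  by rewrite !lerD // ler_wpM2l.
have s0 : 0 <= s.
  have p1 : 1 <= p%:R :> R by rewrite ler1n.
  have q1 : 1 <= q%:R :> R by rewrite ler1n; lia.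
  by rewrite /s !addr_ge0 ?mulr_ge0 //; lra.
have t0 : 0 <= t.
  have p1 : 1 <= p%:R :> R by rewrite ler1n.
  have q1 : 1 <= q%:R :> R by rewrite ler1n; lia.
  by rewrite /t !addr_ge0 ?mulr_ge0 //; lra.
have D0 : 0 < 4 * l * u * c%:R ^+ 2 by rewrite !mulr_gt0 // exprn_gt0.
rewrite -(ler_pM2r D0). rewrite e.
have -> : a * (4 * l * u * c%:R ^+ 2) = 4 * (l * s) * (u * t).
  by rewrite mulrCA -st; ring.
have : (l * s + u * t) ^+ 2 <= g ^+ 2.
  by rewrite ler_sqr ?nnegrE // addr_ge0 // mulr_ge0 // ltW.
apply: le_trans; rewrite -subr_ge0.
have -> : (l * s + u * t) ^+ 2 - 4 * (l * s) * (u * t) = (l * s - u * t) ^+ 2.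
  by ring.
exact: sqr_ge0.
Qed.

Lemma sum_n_out (V : finType) (G : 'I_c -> digraph V) :
  (\sum_i n_out p q G i = \sum_v #|rich_out p q G v|)%N.
Proof.
under eq_bigr do rewrite /n_out -sum1dep_card big_mkcond.
rewrite exchange_big; apply: eq_bigr => v _.
by rewrite -big_mkcond sum1_card.
Qed.

Lemma sum_n_in (V : finType) (G : 'I_c -> digraph V) :
  (\sum_i n_in p q G i = \sum_v #|rich_in p q G v|)%N.
Proof.
under eq_bigr do rewrite /n_in -sum1dep_card big_mkcond.
rewrite exchange_big; apply: eq_bigr => v _.
by rewrite -big_mkcond sum1_card.
Qed.

Lemma exists_le_average (X : 'I_c -> R) :
  exists i, c%:R * X i <= \sum_j X j.
Proof.
have [i _ Xi] := arg_minP X (erefl true : xpredT (Ordinal c_gt0)).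
exists i; have -> : c%:R * X i = \sum_(j < c) X i.
  by rewrite sumr_const card_ord mulr_natl.
by apply: ler_sum => j _; exact: Xi.
Qed.

Lemma min_arcs_le_certified (V : finType) (G : 'I_c -> digraph V) (a : R) :
  certified p q c a -> ~ rainbow_copy G (star p q) ->
  (min_arcs G)%:R <= a * #|V|%:R ^+ 2 + (2 * (p + q))%:R * #|V|%:R.
Proof.
move=> [l [u [g [[l0 u0 g0] [h1 h2 h3 e]]]]] noG.
have C0 : 0 < c%:R :> R by rewrite ltr0n.
pose A v : R := #|rich_out p q G v|%:R; pose B v : R := #|rich_in p q G v|%:R.
have AB v : l * A v + u * B v <= g.
  have Ac : A v <= c%:R by rewrite ler_nat -[leqRHS]card_ord max_card.
  have Bc : B v <= c%:R by rewrite ler_nat -[leqRHS]card_ord max_card.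
  have pred_le (k m : nat) : (k < m)%N -> k%:R <= m%:R - 1 :> R.
    by move=> km; rewrite lerBrDr -(natrD _ k 1) ler_nat addn1.
  have [/pred_le Aq|/pred_le Bp|ABpq] := no_rainbow_star v hp noG.
  - by apply: le_trans h1; rewrite lerD // ler_pM2l.
  - by apply: le_trans h2; rewrite lerD // ler_pM2l.
  - have /pred_le Apq :=
      leq_ltn_trans (subset_leq_card (finset.subsetUl _ _)) ABpq.
    have /pred_le Bpq :=
      leq_ltn_trans (subset_leq_card (finset.subsetUr _ _)) ABpq.
    rewrite natrD in Apq Bpq.
    by apply: le_trans h3; rewrite lerD // ler_pM2l.
(* Averaging the weighted sum, rather than the two counts separately, gives one colour that serves
   for both. *)
have [i Xi] := exists_le_average
  (fun i => l * (n_out p q G i)%:R + u * (n_in p q G i)%:R).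
have {}Xi : c%:R * (l * (n_out p q G i)%:R + u * (n_in p q G i)%:R)
    <= g * #|V|%:R.
  apply: le_trans Xi _; rewrite big_split -!mulr_sumr -!natr_sum.
  rewrite sum_n_out sum_n_in !natr_sum !mulr_sumr -big_split.
  rewrite mulr_natr -sumr_const; apply: ler_sum => v _; exact: AB.
set s := (n_out p q G i)%:R in Xi; set t := (n_in p q G i)%:R in Xi.
(* AM-GM: [4 (l s) (u t) <= (l s + u t) ^ 2]. *)
have st : s * t <= a * #|V|%:R ^+ 2.
  have D0 : 0 < 4 * l * u * c%:R ^+ 2 by rewrite !mulr_gt0 // exprn_gt0.
  rewrite -(ler_pM2r D0) [leRHS]mulrAC e -exprMn.
  have : (c%:R * (l * s + u * t)) ^+ 2 <= (g * #|V|%:R) ^+ 2.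
    by rewrite ler_sqr ?nnegrE ?mulr_ge0 // addr_ge0 // mulr_ge0 // ltW.
  apply: le_trans; rewrite -subr_ge0.
  have -> : (c%:R * (l * s + u * t)) ^+ 2 - s * t * (4 * l * u * c%:R ^+ 2) =
    (c%:R * (l * s - u * t)) ^+ 2 by ring.
  exact: sqr_ge0.
have : ((min_arcs G)%:R : R) <=
    ((n_out p q G i * n_in p q G i + 2 * ((p + q) * #|V|))%N)%:R.
  by rewrite ler_nat (leq_trans (min_arcs_le G i)) // card_arcs_le.
by move/le_trans; apply; rewrite natrD mulnA !natrM lerD.
Qed.

End Bounds.

(** * The window construction and the lower bound *)

Lemma card_window (c k v : nat) : (k <= c)%N ->
  #|[set i : 'I_c | (v + i) %% c < k]%N| = k.
Proof.
move=> kc; rewrite -[RHS](count_window v kc) -sum1dep_card big_mkcond.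
by apply: eq_bigr => i _; case: (_ < k)%N.
Qed.

Section WindowDigraph.
Variables (p q c n : nat) (kA kB : nat -> nat).

(** [kA v] and [kB v] are the numbers of colours available at [v] for outgoing and incoming arcs.
    Both windows start at the same colour, so equal lengths give equal colour sets. *)
Definition window_rel (i : 'I_c) : rel 'I_n := fun u v =>
  [&& u != v, (u + i) %% c < kA u & (v + i) %% c < kB v]%N.

Fact window_irr i : irreflexive (window_rel i).
Proof. by move=> u; rewrite /window_rel eqxx. Qed.

Definition window_digraph (i : 'I_c) : digraph 'I_n := Digraph (@window_irr i).

Lemma window_no_rainbow :
  (forall v, (kA v <= c)%N) -> (forall v, (kB v <= c)%N) ->
  (forall v, [\/ kA v < q, kB v < p | kA v = kB v /\ kA v < p + q]%N) ->
  ~ rainbow_copy window_digraph (star p q).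
Proof.
move=> hA hB small [f [phi [_ phi_inj fG]]].
pose v := f None.
(* The arc of the star at the leaf [x]. *)
pose e (x : 'I_p + 'I_q) : option ('I_p + 'I_q) * option ('I_p + 'I_q) :=
  if x is inl _ then (Some x, None) else (None, Some x).
have he x : e x \in arcs (star p q) by rewrite inE; case: x.
pose col x := phi (exist _ (e x) (he x)).
have col_inj : injective col.
  by move=> x y /phi_inj/(congr1 val) /=; case: x; case: y => a b //= [->].
pose A := [set i : 'I_c | (v + i) %% c < kA v]%N.
pose B := [set i : 'I_c | (v + i) %% c < kB v]%N.
have colB k : col (inl k) \in B.
  by have /and3P[_ _] := fG (exist _ (e (inl k)) (he (inl k))); rewrite inE.
have colA k : col (inr k) \in A.
  by have /and3P[_] := fG (exist _ (e (inr k)) (he (inr k))); rewrite inE.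
have [kAq|kBp|[kAB kApq]] := small v.
- suff : (q <= #|A|)%N by rewrite card_window // leqNgt kAq.
  have inj : injective (fun k => col (inr k)) by move=> x y /col_inj[].
  rewrite -[leqLHS]card_ord -(card_imset _ inj); apply: subset_leq_card.
  by apply/fintype.subsetP => _ /finset.imsetP[k _ ->].
- suff : (p <= #|B|)%N by rewrite card_window // leqNgt kBp.
  have inj : injective (fun k => col (inl k)) by move=> x y /col_inj[].
  rewrite -[leqLHS]card_ord -(card_imset _ inj); apply: subset_leq_card.
  by apply/fintype.subsetP => _ /finset.imsetP[k _ ->].
- suff : (p + q <= #|A|)%N by rewrite card_window // leqNgt kApq.
  rewrite -[p]card_ord -[q]card_ord -card_sum -(card_imset _ col_inj).
  apply: subset_leq_card.
  apply/fintype.subsetP => _ /finset.imsetP[[k|k] _ ->] //.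
  by rewrite /A kAB.
Qed.

(** The product also counts the pairs [(v, v)], at most [n] of them. *)
Lemma card_window_arcs (i : 'I_c) :
  ((\sum_(v < n) ((v + i) %% c < kA v)) * (\sum_(v < n) ((v + i) %% c < kB v))
   <= #|arcs (window_digraph i)| + n)%N.
Proof.
have sumE (k : nat -> nat) : (\sum_(v < n) ((v + i) %% c < k v) =
    #|[set v : 'I_n | (v + i) %% c < k v]|)%N.
  rewrite -sum1dep_card [RHS]big_mkcond.
  by apply: eq_bigr => v _; case: (_ < k v)%N.
rewrite !sumE -cardsX -[X in (_ <= _ + X)%N]card_ord.
have diag_inj : injective (fun v : 'I_n => (v, v)) by move=> u v [].
rewrite -[X in (_ <= _ + X)%N](card_imset _ diag_inj).
apply: leq_trans (leq_card_setU _ _).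
apply: subset_leq_card; apply/fintype.subsetP => -[u v].
rewrite inE !inE /= /window_rel => /andP[-> ->]; rewrite !andbT.
by case: eqP => //= <-; rewrite imset_f.
Qed.

End WindowDigraph.

(** In each block, rounding its size loses at most [1] and its incomplete period less than [c]
    vertices; the factors [k <= c] turn this into [c (c + 1)] per block. *)
Lemma window_count_lower (R : realType) (c i k1 k2 k3 n n1 n2 n3 : nat)
    (x y z : R) :
  (0 < c)%N -> (k1 <= c)%N -> (k2 <= c)%N -> (k3 <= c)%N ->
  n = (n1 + n2 + n3)%N ->
  x * n%:R <= n1%:R + 1 -> y * n%:R <= n2%:R + 1 -> z * n%:R <= n3%:R + 1 ->
  (k1%:R * x + k2%:R * y + k3%:R * z) * n%:R <=
  c%:R * (\sum_(v < n) ((v + i) %% c <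
     if (v < n1)%N then k1 else if (v < n1 + n2)%N then k2 else k3))%N%:R
  + 3 * c%:R * (c%:R + 1).
Proof.
move=> c_gt0 h1 h2 h3 en hx hy hz.
have block (k m : nat) (w : R) : (k <= c)%N -> w * n%:R <= m%:R + 1 ->
    k%:R * w * n%:R <= c%:R * (k * (m %/ c))%:R + c%:R * (c%:R + 1).
  move=> kc wm.
  have mc : m%:R <= c%:R * (m %/ c)%:R + c%:R :> R.
    rewrite -natrM -natrD ler_nat {1}(div.divn_eq m c) mulnC leq_add2l.
    by rewrite ltnW // ltn_pmod.
  have {}kc : k%:R <= c%:R :> R by rewrite ler_nat.
  have k0 : 0 <= k%:R :> R by [].
  have c0 : 0 <= c%:R :> R by [].
  rewrite natrM -mulrA; apply: (@le_trans _ _ (k%:R * (m%:R + 1))).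
    by rewrite ler_wpM2l.
  apply: (@le_trans _ _ (k%:R * (c%:R * (m %/ c)%:R + (c%:R + 1)))).
    by rewrite ler_wpM2l //; lra.
  rewrite mulrDr mulrCA lerD2l ler_wpM2r //; lra.
have := count_three_windows i h1 h2 h3 en.
rewrite -(ler_nat R) !natrD => /(ler_wpM2l (ler0n R c)).
have := block k1 n1 x h1 hx; have := block k2 n2 y h2 hy.
have := block k3 n3 z h3 hz.
by rewrite !mulrDr !mulrDl; lra.
Qed.

Lemma round_weights (R : realType) (x y z : R) (n : nat) :
  0 <= x -> 0 <= y -> 0 <= z -> x + y + z = 1 ->
  exists n1 n2 n3, [/\ n = (n1 + n2 + n3)%N,
    x * n%:R <= n1%:R + 1, y * n%:R <= n2%:R + 1 & z * n%:R <= n3%:R + 1].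
Proof.
move=> x0 y0 z0 xyz.
have /truncn_itv/andP[x1 x2] : 0 <= x * n%:R by rewrite mulr_ge0.
have /truncn_itv/andP[y1 y2] : 0 <= y * n%:R by rewrite mulr_ge0.
set n1 := Num.truncn (x * n%:R) in x1 x2.
set n2 := Num.truncn (y * n%:R) in y1 y2.
have e : x * n%:R + y * n%:R + z * n%:R = n%:R by rewrite -!mulrDl xyz mul1r.
have zn0 : 0 <= z * n%:R by rewrite mulr_ge0.
have le12 : (n1 + n2 <= n)%N by rewrite -(ler_nat R) natrD; lra.
(* The last block takes the rest, which is at least [z n] since truncation only lowers the other
   two. *)
exists n1, n2, (n - (n1 + n2))%N; split; first by rewrite subnKC.
- by apply: ltW; rewrite natr1.
- by apply: ltW; rewrite natr1.
- by rewrite natrB // natrD; lra.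
Qed.

(** If [x] or [y] is at most [D], the left side is already nonpositive; otherwise
    [(x - D) (y - D) <= a b]. *)
Lemma mul_lower (R : realType) (a b x y D n : R) :
  0 <= a -> 0 <= b -> 0 <= D -> 0 <= x <= n -> 0 <= y <= n ->
  x <= a + D -> y <= b + D -> x * y - 2 * D * n <= a * b.
Proof.
move=> a0 b0 D0 /andP[x0 xn] /andP[y0 yn] xa yb.
have [xD|Dx] := leP x D.
  have : x * y <= D * n by rewrite ler_pM.
  have : 0 <= a * b by rewrite mulr_ge0.
  have : 0 <= D * n by rewrite mulr_ge0 // (le_trans x0).
  by lra.
have [yD|Dy] := leP y D.
  have : x * y <= n * D by rewrite ler_pM.
  have : 0 <= a * b by rewrite mulr_ge0.
  have : 0 <= D * n by rewrite mulr_ge0 // (le_trans x0).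
  by lra.
have : (x - D) * (y - D) <= a * b by rewrite ler_pM //; lra.
have : D * x <= D * n by rewrite ler_wpM2l.
have : D * y <= D * n by rewrite ler_wpM2l.
have : 0 <= D * D by rewrite mulr_ge0.
by lra.
Qed.

(** Three blocks of vertices in proportions [x], [y], [z] carry the window lengths of the three
    vertices of the triangle. The error is [2 D n] with [D = 3 (c + 1)], plus [n] for the
    diagonal. *)
Lemma attained_construction (R : realType) (p q c n : nat) (a : R) :
  (1 <= p)%N -> (p <= q)%N -> (p + q <= c)%N -> attained p q c a ->
  exists2 G : 'I_c -> digraph 'I_n, ~ rainbow_copy G (star p q) &
    a * n%:R ^+ 2 - (6 * (c%:R + 1) + 1) * n%:R <= (min_arcs G)%:R.
Proof.
move=> hp hpq hc [x [y [z [x0 y0 z0 xyz st]]]].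
have c_gt0 : (0 < c)%N by lia.
have C0 : 0 < c%:R :> R by rewrite ltr0n.
have [n1 [n2 [n3 [en xn yn zn]]]] := round_weights n x0 y0 z0 xyz.
pose k j1 j2 j3 v : nat :=
  if (v < n1)%N then j1 else if (v < n1 + n2)%N then j2 else j3.
pose kA := k q.-1 c (p + q).-1; pose kB := k c p.-1 (p + q).-1.
have predR (m : nat) : (0 < m)%N -> m.-1%:R = m%:R - 1 :> R.
  by case: m => // m _; rewrite -natr1 addrK.
have q0 : (0 < q)%N by lia.
have pq0 : (0 < p + q)%N by lia.
have [pc qc mc] : [/\ p.-1 <= c, q.-1 <= c & (p + q).-1 <= c]%N by split; lia.
exists (window_digraph n kA kB).
  apply: window_no_rainbow => v; rewrite /kA /kB /k.
  - by case: ifP => // _; case: ifP.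
  - by case: ifP => // _; case: ifP.
  - case: ifP => _; first by constructor 1; rewrite prednK.
    case: ifP => _; first by constructor 2; rewrite prednK.
    by constructor 3; rewrite prednK.
set s := (X in X * _) in st; set t := (X in _ * X) in st.
have bound (u1 u2 u3 : R) :
    0 <= u1 <= c%:R -> 0 <= u2 <= c%:R -> 0 <= u3 <= c%:R ->
    0 <= u1 * x + u2 * y + u3 * z <= c%:R.
  move=> /andP[? ?] /andP[? ?] /andP[? ?]; apply/andP; split.
    by rewrite !addr_ge0 // mulr_ge0.
  have <- : c%:R * x + c%:R * y + c%:R * z = c%:R by rewrite -!mulrDr xyz mulr1.
  by apply: lerD; [apply: lerD|]; apply: ler_wpM2r.
have natb (m : nat) : (m <= c)%N -> 0 <= (m%:R : R) <= c%:R.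
  by move=> mc'; rewrite ler0n ler_nat.
have sE : s = q.-1%:R * x + c%:R * y + (p + q).-1%:R * z.
  by rewrite /s !predR // natrD.
have tE : t = c%:R * x + p.-1%:R * y + (p + q).-1%:R * z.
  by rewrite /t !predR // natrD.
have /andP[s0 sc] : 0 <= s <= c%:R by rewrite sE bound ?natb.
have /andP[t0 tc] : 0 <= t <= c%:R by rewrite tE bound ?natb.
have aE : a = (s / c%:R) * (t / c%:R).
  apply: (@mulIf _ (c%:R ^+ 2)); first by rewrite expf_neq0 // gt_eqF.
  by rewrite -st; field; rewrite gt_eqF.
(* Needed against the default [n ^ 2] of the minimum. *)
have a1 : a <= 1.
  by rewrite aE -[leRHS]mulr1 ler_pM ?divr_ge0 ?ler_pdivrMr ?mul1r // ltW.
have n0 : 0 <= n%:R :> R by [].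
have K0 : 0 <= 6 * (c%:R + 1) + 1 :> R by lra.
apply: le_min_arcs => [|i].
  rewrite card_ord lerBlDr (le_trans (_ : _ <= n%:R ^+ 2)) ?lerDl ?mulr_ge0 //.
  by rewrite -[leRHS]mul1r ler_wpM2r // exprn_ge0.
have HA := window_count_lower i c_gt0 qc (leqnn c) mc en xn yn zn.
have HB := window_count_lower i c_gt0 (leqnn c) pc mc en xn yn zn.
have := card_window_arcs n kA kB i.
rewrite -sE in HA; rewrite -tE in HB.
rewrite -(ler_nat R) natrD natrM -lerBlDr; apply: le_trans.
rewrite /kA /kB /k.
set a_ := (X in _ <= X * _ - _); set b_ := (X in _ <= _ * X - _).
have scale (w v : R) : w * n%:R <= c%:R * v + 3 * c%:R * (c%:R + 1) ->
    w / c%:R * n%:R <= v + 3 * (c%:R + 1).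
  by move=> h; rewrite mulrAC ler_pdivrMr //; move: h; lra.
have frac (w : R) : 0 <= w -> w <= c%:R -> 0 <= w / c%:R * n%:R <= n%:R.
  move=> w0 wc; rewrite mulr_ge0 ?divr_ge0 ?(ltW C0) //=.
  by rewrite ler_piMl // ler_pdivrMr // mul1r.
have D0 : 0 <= 3 * (c%:R + 1) :> R by lra.
have := mul_lower (ler0n R _) (ler0n R _) D0 (frac s s0 sc) (frac t t0 tc)
  (scale _ _ HA) (scale _ _ HB).
rewrite -/a_ -/b_ aE => h.
suff -> : s / c%:R * (t / c%:R) * n%:R ^+ 2 =
  s / c%:R * n%:R * (t / c%:R * n%:R) by lra.
by ring.
Qed.

(** * Linear error terms and the final assembly *)

Local Open Scope classical_set_scope.

Lemma littleo_linear (R : realType) (K : R) :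
  (fun n : nat => K * n%:R) =o_\oo (fun n => n%:R ^+ 2 : R).
Proof.
apply/eqoP => e e0; near=> n.
rewrite normrM normrX normr_nat expr2 mulrA ler_wpM2r //.
rewrite mulrC -ler_pdivrMr //; near: n; exact: nbhs_infty_ger.
Unshelve. all: by end_near.
Qed.

Theorem theorem4 (R : realType) (p q c : nat)
    (hp : (1 <= p)%N) (hpq : (p <= q)%N) (hc : (p + q <= c)%N) :
  [/\ ((t1 R p q)%:E <= t2 R p q)%E,
      t1 R p q <= t3 R p q,
      order_t234 R p q \/ order_t432 R p q,
      exists2 eps : nat -> R,
        eps =o_\oo (fun n => n%:R ^+ 2 : R) &
        forall n : nat, (0 < n)%N ->
        forall V : finType, #|V| = n ->
        forall G : 'I_c -> digraph V, ~ rainbow_copy G (star p q) ->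
        in_each_case p q c
          (fun a : R => (min_arcs G)%:R <= a * n%:R ^+ 2 + eps n)
    & exists2 eps : nat -> R,
        eps =o_\oo (fun n => n%:R ^+ 2 : R) &
        forall n : nat, exists2 G : 'I_c -> digraph 'I_n,
        ~ rainbow_copy G (star p q) &
        in_each_case p q c
          (fun a : R => a * n%:R ^+ 2 - eps n <= (min_arcs G)%:R)].
Proof.
have optimum := certified_and_attained_each R hp hpq hc.
split.
- exact: t1_le_t2.
- exact: t1_le_t3.
- exact: t234_or_t432.
- exists (fun n => (2 * (p + q))%:R * n%:R); first exact: littleo_linear.
  move=> n _ V Vn G noG; apply: in_each_case_impl optimum => a [cert _].
  by rewrite -Vn; exact: min_arcs_le_certified.
- exists (fun n => (6 * (c%:R + 1) + 1) * n%:R); first exact: littleo_linear.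
  move=> n.
  (* When several cases apply to [c], one collection serves them all: each of
     their coefficients is the same maximum over the triangle. *)
  have [a0 [cert0 att0]] := some_case (t234_or_t432 R hp hpq hc) optimum.
  have [G noG Gmin] := attained_construction n hp hpq hc att0.
  exists G => //; apply: in_each_case_impl optimum => a [_ att].
  apply: le_trans Gmin; rewrite lerD2r ler_wpM2r ?exprn_ge0 //.
  exact: attained_le_certified att cert0.
Qed.
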